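(* Let $A_1,A_2\in\mathbb{R}^{n\times n}$ and $B_1,B_2\in\mathbb{R}^{n\times m}$. The systems $\dot x(t)=A_1x(t)+B_1u(t)$ and $\dot y(t)=A_2y(t)+B_2v(t)$ are linearly equivalent if and only if there are real matrices $O$, $Q$ and $L$ of dimensions $n\times n$, $m\times m$ and $m\times n$, respectively, with $O$ and $Q$ nonsingular, such that $$A_2=O^{-1}A_1O+O^{-1}B_1L,\qquad B_2=O^{-1}B_1Q.$$
   Context: For real matrices $A$ ($n\times n$) and $B$ ($n\times m$), $(A,B)$ denotes the linear controlled system $\dot x(t)=Ax(t)+Bu(t)$, $t\ge 0$, with state $x(t)\in\mathbb{R}^n$ and control $u(t)\in\mathbb{R}^m$. Let $F(x,u)=(H(x),G(x,u))$ with $H:\mathbb{R}^n\to\mathbb{R}^n$ and $G:\mathbb{R}^n\times\mathbb{R}^m\to\mathbb{R}^m$ continuous. One says that $F$ brings $(A_1,B_1)$ to $(A_2,B_2)$ if for every $x^0\in\mathbb{R}^n$ and every $u\in C([0,+\infty);\mathbb{R}^m)$, whenever $x(t)$ is the solution of $(A_1,B_1)$ with $x(0)=x^0$ and control $u$, then $y(t)=H(x(t))$ is the solution of $(A_2,B_2)$ with $y(0)=H(x^0)$ and control $v(t)=G(x(t),u(t))$. Systems $(A_1,B_1)$ and $(A_2,B_2)$ are topologically equivalent if there is such an $F$ which is a homeomorphism of $\mathbb{R}^n\times\mathbb{R}^m$ onto itself, with inverse of the form $F^{-1}(y,v)=(H^{-1}(y),W(y,v))$, such that $F$ brings $(A_1,B_1)$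 to $(A_2,B_2)$ and $F^{-1}$ brings $(A_2,B_2)$ to $(A_1,B_1)$. They are linearly equivalent if in addition $F$ can be chosen to be a linear isomorphism of $\mathbb{R}^n\times\mathbb{R}^m$ onto itself. *)

(* Defs.v *)
From HB Require Import structures.
From mathcomp Require Import all_boot all_order all_algebra.
From mathcomp Require Import all_classical all_reals all_analysis.

Set Implicit Arguments.
Unset Strict Implicit.
Unset Printing Implicit Defensive.

Import Order.TTheory GRing.Theory Num.Theory.
Import numFieldNormedType.Exports.

Local Open Scope classical_set_scope.
Local Open Scope ring_scope.

(* Trajectories and controls live on [0, +oo): they are total functions on R
   whose values at negative times are never looked at. *)

Definition admissible_control (R : realType) (m : nat) (u : R -> 'cV[R]_m) :
    Prop :=
  {within `[0, +oo[, continuous u}.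

(* The derivative is taken within [0, +oo), hence is one-sided at t = 0. *)
Definition is_solution (R : realType) (n m : nat)
    (A : 'M[R]_n) (B : 'M[R]_(n, m)) (x0 : 'cV[R]_n) (u : R -> 'cV[R]_m)
    (x : R -> 'cV[R]_n) : Prop :=
  x 0 = x0 /\
  forall t : R, 0 <= t ->
    (fun s : R => (s - t)^-1 *: (x s - x t)) @ within `[0, +oo[ t^'
      --> A *m x t + B *m u t.

Definition feedback_map (R : realType) (n m : nat)
    (H : 'cV[R]_n -> 'cV[R]_n) (G : 'cV[R]_n * 'cV[R]_m -> 'cV[R]_m) :
    'cV[R]_n * 'cV[R]_m -> 'cV[R]_n * 'cV[R]_m :=
  fun p => (H p.1, G p).

Definition brings (R : realType) (n m : nat)
    (H : 'cV[R]_n -> 'cV[R]_n) (G : 'cV[R]_n * 'cV[R]_m -> 'cV[R]_m)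
    (A1 : 'M[R]_n) (B1 : 'M[R]_(n, m)) (A2 : 'M[R]_n) (B2 : 'M[R]_(n, m)) :
    Prop :=
  forall (x0 : 'cV[R]_n) (u : R -> 'cV[R]_m), admissible_control u ->
  forall x : R -> 'cV[R]_n, is_solution A1 B1 x0 u x ->
    is_solution A2 B2 (H x0) (fun t => G (x t, u t)) (fun t => H (x t)).

(* [(Hi, W)] are the components of the inverse of [feedback_map H G]. *)
Definition equivalence_by (R : realType) (n m : nat)
    (A1 : 'M[R]_n) (B1 : 'M[R]_(n, m)) (A2 : 'M[R]_n) (B2 : 'M[R]_(n, m))
    (H : 'cV[R]_n -> 'cV[R]_n) (G : 'cV[R]_n * 'cV[R]_m -> 'cV[R]_m)
    (Hi : 'cV[R]_n -> 'cV[R]_n) (W : 'cV[R]_n * 'cV[R]_m -> 'cV[R]_m) : Prop :=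
  [/\ [/\ continuous H, continuous G, continuous Hi & continuous W],
      cancel H Hi /\ cancel Hi H,
      cancel (feedback_map H G) (feedback_map Hi W) /\
        cancel (feedback_map Hi W) (feedback_map H G),
      brings H G A1 B1 A2 B2 &
      brings Hi W A2 B2 A1 B1].

Definition topologically_equivalent (R : realType) (n m : nat)
    (A1 : 'M[R]_n) (B1 : 'M[R]_(n, m)) (A2 : 'M[R]_n) (B2 : 'M[R]_(n, m)) :
    Prop :=
  exists H G Hi W, equivalence_by A1 B1 A2 B2 H G Hi W.

Definition linearly_equivalent (R : realType) (n m : nat)
    (A1 : 'M[R]_n) (B1 : 'M[R]_(n, m)) (A2 : 'M[R]_n) (B2 : 'M[R]_(n, m)) :
    Prop :=
  exists H G Hi W,
    equivalence_by A1 B1 A2 B2 H G Hi W /\ linear (feedback_map H G).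

(* Main.v *)
Require Import Defs.
From HB Require Import structures.
From mathcomp Require Import all_boot all_order all_algebra.
From mathcomp Require Import all_classical all_reals all_analysis.

Set Implicit Arguments.
Unset Strict Implicit.
Unset Printing Implicit Defensive.

Import Order.TTheory GRing.Theory Num.Theory.
Import numFieldNormedType.Exports.

Local Open Scope ring_scope.

(** A linear feedback transformation has the form [H x = P x],
[G (x, u) = K x + S u]. Carrying a solution [x] with control [u] through it
gives [y = P x], whose derivative is [P A1 x + P B1 u], whereas the second
system asks for [A2 P x + B2 (K x + S u)]. So the transformation brings the
first system to the second exactly when these two expressions agree along all
trajectories, that is, when

  [P A1 = A2 P + B2 K]  and  [P B1 = B2 S]     ([brings_linear]).

Sufficiency is immediate. For necessity, one compares the two expressions at
time [0], which needs every pair [(x0, u0)] to be the initial state and the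
initial control value of some trajectory ([solution_exists]). Such a
trajectory is read off from a solution of the autonomous system
[x' = A x + B u], [u' = 0] on the product of the two spaces, and an
autonomous linear system is solved by its exponential series
([linear_ode]).

The rest is algebra: the transformation is bijective iff [P] and [S] are
invertible, and the substitution [O = P^-1], [Q = S^-1], [L = - S^-1 K P^-1]
turns the two intertwining identities into those of the theorem. The inverse
transformation is [(y, v) |-> (O y, L y + Q v)]. *)

(** * Linear maps between spaces of column vectors *)

Lemma linear_mulmx_cV (K : fieldType) (n p : nat) (f : 'cV[K]_n -> 'cV[K]_p) :
  linear f -> exists M : 'M[K]_(p, n), f =1 mulmx M.
Proof.
move=> lf; pose g (v : 'rV[K]_n) := (f v^T)^T.
have lg : linear g by move=> a u v; rewrite /g !linearP lf linearP.
pose gL := GRing.isLinear.Build _ _ _ _ g lg.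
pose g' : {linear 'rV[K]_n -> 'rV[K]_p} := HB.pack g gL.
exists (lin1_mx g')^T => x.
by rewrite -[x in RHS]trmxK -trmx_mul mul_rV_lin1 /= /g !trmxK.
Qed.

Lemma linear_mulmx_pair (K : fieldType) (n m p : nat)
    (g : 'cV[K]_n * 'cV[K]_m -> 'cV[K]_p) :
  linear g -> exists (M : 'M[K]_(p, n)) (N : 'M[K]_(p, m)),
    g = fun q => M *m q.1 + N *m q.2.
Proof.
move=> lg.
have [|M gM] := @linear_mulmx_cV _ _ _ (fun x => g (x, 0)).
  by move=> a x y; rewrite -lg; congr (g (_, _)); rewrite /= scaler0 addr0.
have [|N gN] := @linear_mulmx_cV _ _ _ (fun u => g (0, u)).
  by move=> a u v; rewrite -lg; congr (g (_, _)); rewrite /= scaler0 addr0.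
exists M, N; apply/funext => -[x u] /=; rewrite -gM -gN -[g (x, 0)]scale1r -lg.
by congr (g (_, _)); rewrite /= scale1r ?addr0 ?add0r.
Qed.

Lemma unitmx_mulmx_inj (K : fieldType) (n : nat) (M : 'M[K]_n) :
  injective (mulmx M : 'cV[K]_n -> 'cV[K]_n) -> M \in unitmx.
Proof.
move=> injM; rewrite unitmxE unitfE -det_tr; apply/det0P => -[v v0 vM0].
case/negP: v0; apply/eqP; apply: trmx_inj; apply: injM.
by rewrite trmx0 mulmx0 -[M]trmxK -trmx_mul vM0 trmx0.
Qed.

Lemma mulmx_ext_cV (K : fieldType) (n p : nat) (M N : 'M[K]_(p, n)) :
  (forall x : 'cV[K]_n, M *m x = N *m x) -> M = N.
Proof.
move=> eqMN; apply/matrixP => i j.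
by have /colP/(_ i) := eqMN (delta_mx j 0); rewrite -!colE !mxE.
Qed.

(** * Limits of matrix-valued functions *)

Local Open Scope classical_set_scope.

Section MatrixLimits.
Variable R : realType.

(** The topology on matrices is the product topology of the entries; as there
are finitely many of them, limits may be taken entry by entry. This reduces
statements on vector trajectories to real functions. *)
Lemma cvg_mxP (T : Type) (F : set_system T) (FF : Filter F) (m n : nat)
    (f : T -> 'M[R]_(m, n)) (M : 'M[R]_(m, n)) :
  f @ F --> M <-> forall i j, (fun t => f t i j) @ F --> M i j.
Proof.
split=> [fM i j|fM].
  apply: (cvg_comp f (fun N : 'M[R]_(m, n) => N i j) fM).
  exact: coord_continuous.
move=> A [P nbP PA].
suff : \forall t \near F, forall i j, P i j (f t i j).
  by apply: filterS => t; exact: PA.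
apply: filter_forall => i; apply: filter_forall => j.
exact: (fM i j _ (nbP i j)).
Qed.

Lemma mulmx_continuous (n p : nat) (M : 'M[R]_(p, n)) :
  continuous (mulmx M : 'cV[R]_n -> 'cV[R]_p).
Proof.
move=> x; apply/(cvg_mxP (nbhs_filter x)) => i j.
rewrite mxE (_ : (fun t : 'cV[R]_n => _) =
  fun t : 'cV[R]_n => \sum_k M i k * t k j); last first.
  by apply/funext => t; rewrite mxE.
apply: cvg_big => [|k _]; first exact: add_continuous.
apply: cvgMl_tmp. exact: coord_continuous.
Qed.

Lemma linear_feedback_continuous (n m p : nat) (K : 'M[R]_(p, n))
    (S : 'M[R]_(p, m)) :
  continuous (fun q : 'cV[R]_n * 'cV[R]_m => K *m q.1 + S *m q.2).
Proof.
move=> q; apply: cvgD.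
  apply: (cvg_comp fst (mulmx K)); [exact: cvg_fst|exact: mulmx_continuous].
apply: (cvg_comp snd (mulmx S)); [exact: cvg_snd|exact: mulmx_continuous].
Qed.

End MatrixLimits.

(** * The exponential series of a matrix *)

Section MatrixFlow.
Variables (R : realType) (n : nat) (A : 'M[R]_n).

(** The coefficient of [t ^ k] in the [i]-th coordinate of [exp (t A) z]. *)
Definition flow_coeff (z : 'cV[R]_n) (i : 'I_n) (k : nat) : R :=
  iter k (mulmx A) z i 0 / k`!%:R.

(** The [i]-th coordinate of [exp (t A) z]; the exponential is kept in
coordinates so that the theory of real power series applies to it. *)
Definition flow (z : 'cV[R]_n) (i : 'I_n) (t : R) : R :=
  limn (pseries (flow_coeff z i) t).

(** The sum of all [`|A i j|] dominates every row sum, so that multiplying by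
[A] enlarges the coordinates by at most this factor. The geometric growth
makes the exponential series converge everywhere. *)
Lemma iter_mulmx_bound (z : 'cV[R]_n) (i : 'I_n) (k : nat) :
  `|iter k (mulmx A) z i 0| <=
  (\sum_i `|z i 0|) * (\sum_i \sum_j `|A i j|) ^+ k.
Proof.
set C : R := \sum_i `|z i 0|; set M : R := \sum_i _.
elim: k i => [|k IH] i /=.
  rewrite expr0 mulr1 /C (bigD1 i) //= lerDl; exact: sumr_ge0.
rewrite mxE (le_trans (ler_norm_sum _ _ _)) //.
have C0 : 0 <= C * M ^+ k.
  by rewrite mulr_ge0 ?exprn_ge0 ?sumr_ge0 // => *; rewrite sumr_ge0.
apply: (@le_trans _ _ (\sum_j `|A i j| * (C * M ^+ k))).
  by apply: ler_sum => j _; rewrite normrM ler_wpM2l.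
rewrite -mulr_suml exprS [leRHS]mulrCA ler_wpM2r // /M [leRHS](bigD1 i) //= lerDl.
by apply: sumr_ge0 => l _; exact: sumr_ge0.
Qed.

Lemma is_cvg_flow (z : 'cV[R]_n) (i : 'I_n) (t : R) :
  cvgn (pseries (flow_coeff z i) t).
Proof.
set C : R := \sum_i `|z i 0|; set M : R := \sum_i \sum_j `|A i j|.
apply: normed_cvg.
apply: (@series_le_cvg _ _ (fun k => C * exp_coeff (M * `|t|) k)).
- by move=> k; exact: normr_ge0.
- move=> k; rewrite mulr_ge0 ?sumr_ge0 // exp_coeff_ge0 // mulr_ge0 //.
  by rewrite sumr_ge0 // => *; exact: sumr_ge0.
- move=> k; rewrite /flow_coeff /exp_coeff /= !normrM normfV normrX exprMn.
  rewrite normr_nat mulrAC !mulrA.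
  by rewrite ler_wpM2r ?invr_ge0 // ler_wpM2r ?exprn_ge0 // iter_mulmx_bound.
- have := is_cvg_seriesZ (k := C) (is_cvg_series_exp_coeff (M * `|t|)).
  by rewrite (_ : _ *: _ = fun k => C * exp_coeff (M * `|t|) k).
Qed.

(** Formal differentiation of [exp (t A) z] in [t] amounts to replacing [z] by
[A z]; hence the derived series are again exponential series, and their
convergence needs no separate argument. *)
Lemma flow_coeff_diffs (z : 'cV[R]_n) (i : 'I_n) :
  pseries_diffs (flow_coeff z i) = flow_coeff (A *m z) i.
Proof.
apply/funext => k; rewrite /pseries_diffs /flow_coeff -iterSr factS natrM invfM.
by rewrite mulrCA mulVKf.
Qed.

Lemma flow_mulmx (z : 'cV[R]_n) (i : 'I_n) (t : R) :
  flow (A *m z) i t = \sum_j A i j * flow z j t.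
Proof.
apply/cvg_lim => //.
rewrite (_ : pseries _ t =
  fun N => \sum_j A i j * pseries (flow_coeff z j) t N); last first.
  apply/funext => N; rewrite /pseries /series /=.
  under [RHS]eq_bigr do rewrite mulr_sumr.
  rewrite exchange_big /=; apply: eq_bigr => k _.
  rewrite /flow_coeff -iterSr iterS mxE !mulr_suml.
  by apply: eq_bigr => j _; rewrite !mulrA.
apply: cvg_big => [|j _]; first exact: add_continuous.
apply: cvgMl_tmp. exact: is_cvg_flow.
Qed.

Lemma flow0 (z : 'cV[R]_n) (i : 'I_n) : flow z i 0 = z i 0.
Proof.
apply: lim_near_cst => //; near=> N.
have N0 : (0 < N)%N by near: N; exists 1%N.
rewrite /pseries /series /= -(prednK N0) big_nat_recl // big1 ?addr0.
  by rewrite /flow_coeff /= fact0 invr1 expr0 !mulr1.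
by move=> k _; rewrite expr0n mulr0.
Unshelve. all: by end_near. Qed.

(** Termwise differentiation is valid strictly inside a disc of convergence;
since the series converges everywhere, radius [`|t| + 1] will do. *)
Lemma flow_is_derive (z : 'cV[R]_n) (i : 'I_n) (t : R) :
  is_derive t 1 (flow z i) (\sum_j A i j * flow z j t).
Proof.
rewrite -flow_mulmx /flow -flow_coeff_diffs.
apply: (@pseries_snd_diffs _ _ (`|t| + 1)).
- exact: is_cvg_flow.
- by rewrite flow_coeff_diffs; exact: is_cvg_flow.
- by rewrite !flow_coeff_diffs; exact: is_cvg_flow.
- by rewrite [ltRHS]ger0_norm ?addr_ge0 // ltrDl.
Qed.

Lemma linear_ode (z0 : 'cV[R]_n) : exists z : R -> 'cV[R]_n,
  z 0 = z0 /\
  forall (t : R) (i : 'I_n), is_derive t 1 (fun s => z s i 0) ((A *m z t) i 0).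
Proof.
exists (fun t => \col_i flow z0 i t); split.
  by apply/colP => i; rewrite mxE flow0.
move=> t i.
rewrite (_ : (fun s => _) = flow z0 i); last first.
  by apply/funext => s; rewrite mxE.
rewrite (_ : _ i 0 = \sum_j A i j * flow z0 j t); first exact: flow_is_derive.
by rewrite mxE; apply: eq_bigr => j _; rewrite mxE.
Qed.

End MatrixFlow.

(** * Trajectories of controlled systems *)

Section Solutions.
Variable R : realType.

(** Passes from the increment form of the derivative used by [is_derive] to the
difference quotients restricted to a domain that define solutions. *)
Lemma is_derive_within (f : R -> R) (t d : R) (D : set R) :
  is_derive t 1 f d ->
  (fun s => (s - t)^-1 *: (f s - f t)) @ within D t^' --> d.
Proof.
move=> df; have : h^-1 *: (f (h *: 1 + t) - f t) @[h --> 0^'] --> d.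
  by have [/cvg_ex[l fl] <-] := df; rewrite /derive; apply: cvgP fl.
move=> dfl.
apply: cvg_trans (_ : (fun s => (s - t)^-1 *: (f s - f t)) @ t^' --> d).
  exact: cvg_within_filter.
have st : (fun s : R => s - t) @ t^' --> 0^'.
  move=> S /nbhs_ballP[e /= e0 eS]; apply/nbhs_ballP; exists e => //= s.
  rewrite /ball /= => ts st; apply: eS; rewrite /ball /= ?subr_eq0 //.
  by rewrite sub0r opprB.
rewrite (_ : (fun s => _) =
  (fun h => h^-1 *: (f (h *: 1 + t) - f t)) \o (fun s : R => s - t)).
  exact: cvg_comp st dfl.
by apply/funext => s /=; rewrite [(s - t)%:A]mulr1 subrK.
Qed.

(** Limits within [[0, +oo)] are unique also at the end point [0], because the
ray contains a right neighbourhood of each of its points. *)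
Lemma dnbhs_within_ray_proper (t : R) :
  0 <= t -> ProperFilter (within `[0, +oo[ t^').
Proof.
move=> t0; apply: Build_ProperFilter => F0.
have : t^'+ set0; last exact: filter_not_empty.
move: F0; rewrite /within /dnbhs /at_right /within /=.
apply: (@filterS _ (nbhs t)) => s F0 ts; apply: F0; first by rewrite gt_eqF.
by rewrite /= in_itv /= andbT (le_trans t0) // ltW.
Qed.

(** The control is treated as a further state variable with zero derivative, so
that a solution of the enlarged autonomous system yields both [x] and [u]. *)
Lemma solution_exists (n m : nat) (A : 'M[R]_n) (B : 'M[R]_(n, m))
    (x0 : 'cV[R]_n) (u0 : 'cV[R]_m) :
  exists u x, [/\ admissible_control u, u 0 = u0 & is_solution A B x0 u x].
Proof.
have [z [z0 dz]] := linear_ode (block_mx A B 0 0) (col_mx x0 u0).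
exists (dsubmx \o z), (usubmx \o z); split.
- apply: continuous_subspaceT => t; apply/(cvg_mxP (nbhs_filter t)) => i j.
  rewrite ord1 (_ : (fun s => _) = fun s => z s (rshift n i) 0); last first.
    by apply/funext => s; rewrite mxE.
  rewrite mxE; have [dzt _] := dz t (rshift n i).
  exact/differentiable_continuous/derivable1_diffP.
- by rewrite /= z0 col_mxKd.
split=> [|t t0]; first by rewrite /= z0 col_mxKu.
apply/(cvg_mxP _) => i j; rewrite ord1.
rewrite (_ : (fun s => _) =
  fun s => (s - t)^-1 *: (z s (lshift m i) 0 - z t (lshift m i) 0)); last first.
  by apply/funext => s; rewrite !mxE.
rewrite (_ : _ i 0 = (block_mx A B 0 0 *m z t) (lshift m i) 0).
  exact: is_derive_within.
by rewrite -[z t in RHS]vsubmxK mul_block_col col_mxEu.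
Qed.

(** Evaluating the transported equation at time [0] along the trajectory with
initial data [(x0, u0)] gives an identity that is linear in arbitrary
[(x0, u0)], and its two matrix coefficients are the intertwining relations.
Conversely these relations make the transported equation hold at every
time. *)
Lemma brings_linear (n m : nat) (A1 A2 : 'M[R]_n) (B1 B2 : 'M[R]_(n, m))
    (P : 'M[R]_n) (K : 'M[R]_(m, n)) (S : 'M[R]_m) :
  brings (mulmx P) (fun p => K *m p.1 + S *m p.2) A1 B1 A2 B2 <->
  P *m A1 = A2 *m P + B2 *m K /\ P *m B1 = B2 *m S.
Proof.
have dP (x : R -> 'cV[R]_n) (t : R) (l : 'cV[R]_n) :
    (fun s => (s - t)^-1 *: (x s - x t)) @ within `[0, +oo[ t^' --> l ->
    (fun s => (s - t)^-1 *: (P *m x s - P *m x t)) @ within `[0, +oo[ t^'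
      --> P *m l.
  move=> xl; rewrite (_ : (fun s => _) =
      mulmx P \o (fun s => (s - t)^-1 *: (x s - x t))).
    by apply: (cvg_comp _ (mulmx P) xl); exact: mulmx_continuous.
  by apply/funext => s /=; rewrite -scalemxAr mulmxBr.
split=> [br|[PA PB] x0 u _ x [x00 xl]].
  have key (x0 : 'cV[R]_n) (u0 : 'cV[R]_m) :
      P *m (A1 *m x0 + B1 *m u0) = A2 *m (P *m x0) + B2 *m (K *m x0 + S *m u0).
    have [u [x [uc u00 xsol]]] := solution_exists A1 B1 x0 u0.
    have [_ /(_ 0 (lexx _)) y'0] := br x0 u uc x xsol.
    have [x00 /(_ 0 (lexx _)) /dP x'0] := xsol.
    rewrite -x00 -u00.
    have PF := dnbhs_within_ray_proper (lexx (0 : R)).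
    exact: (cvg_unique _ x'0 y'0).
  split; apply: mulmx_ext_cV => v.
    by have := key v 0; rewrite !mulmx0 !addr0 !mulmxDl !mulmxA.
  by have := key 0 v; rewrite !mulmx0 !add0r !mulmxA.
split; first by rewrite x00.
move=> t t0; have := dP _ _ _ (xl t t0).
by rewrite mulmxDr !mulmxA PA PB mulmxDl mulmxDr !mulmxA addrA.
Qed.

End Solutions.

Theorem theorem3p1 (R : realType) (n m : nat)
    (A1 A2 : 'M[R]_n) (B1 B2 : 'M[R]_(n, m)) :
  linearly_equivalent A1 B1 A2 B2 <->
  exists (O : 'M[R]_n) (Q : 'M[R]_m) (L : 'M[R]_(m, n)),
    [/\ O \in unitmx, Q \in unitmx,
        A2 = invmx O *m A1 *m O + invmx O *m B1 *m L &
        B2 = invmx O *m B1 *m Q].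
Proof.
split=> [[H [G [Hi [W [[_ [HK _] [FK _] br _] linF]]]]]|].
  have lH : linear H.
    by move=> a x y; have := congr1 fst (linF a (x, 0) (y, 0)).
  have lG : linear G by move=> a p q; have := congr1 snd (linF a p q).
  have [P HP] := linear_mulmx_cV lH; have [K [S GE]] := linear_mulmx_pair lG.
  have {}HP : H = mulmx P by apply/funext.
  move: br; rewrite HP GE => /brings_linear [PA PB].
  have Pu : P \in unitmx.
    by apply: unitmx_mulmx_inj; rewrite -HP; exact: can_inj HK.
  have Su : S \in unitmx.
    apply: unitmx_mulmx_inj => u v Suv.
    suff /(can_inj FK)[] : feedback_map H G (0, u) = feedback_map H G (0, v) by [].
    by rewrite /feedback_map GE /= Suv.
  (* [O] must be the inverse of [P], as [H] goes from the first system to the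
     second while [O] takes states of the second to states of the first. *)
  exists (invmx P), (invmx S), (- (invmx S *m K *m invmx P)).
  rewrite !unitmx_inv invmxK PA PB mulmxK //; split=> //.
  by rewrite mulmxDl mulmxK // mulmxN !mulmxA mulmxK // addrK.
move=> [ O [Q [L [Ou Qu A2E B2E]]]].
(* The forward feedback is found by solving [u = L y + Q v] with [x = O y]
   for [v]. *)
pose K := - (invmx Q *m L *m invmx O).
exists (mulmx (invmx O)), (fun p => K *m p.1 + invmx Q *m p.2), (mulmx O),
  (fun p => L *m p.1 + Q *m p.2); split.
  split.
  - split; do ?exact: mulmx_continuous; exact: linear_feedback_continuous.
  - by split=> x; rewrite mulmxA ?mulmxV ?mulVmx // mul1mx.
  - split=> -[x u]; rewrite /feedback_map /=; congr (_, _);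
      rewrite ?mulmxA ?mulmxV ?mulVmx ?mul1mx //.
      by rewrite mulmxDr /K !mulNmx mulmxN !mulmxA mulmxV // !mul1mx addrA subrr add0r.
    rewrite mulmxDr /K !mulNmx !mulmxA mulmxKV // mulVmx // mul1mx addrA addNr.
    exact: add0r.
  - apply/brings_linear; rewrite A2E B2E /K; split.
      by rewrite mulmxN mulmxDl !mulmxA !mulmxK // addrK.
    by rewrite mulmxK.
  - apply/brings_linear; rewrite A2E B2E; split.
      by rewrite mulmxDr !mulmxA mulmxV // !mul1mx.
    by rewrite !mulmxA mulmxV // mul1mx.
move=> a [x u] [y v]; rewrite /feedback_map /=; congr (_, _) => /=.
  by rewrite mulmxDr scalemxAr.
by rewrite !mulmxDr -!scalemxAr scalerDr addrACA.
Qed.
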